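(* Assume that $\lambda_{m-1}<\lambda_m$ if $m>1$, that $\lambda_M<\lambda_{M+1}$, and that $\|\gamma_hv\|\ne0$ for all $v\in\mathrm{Span}\{\varphi_m^0,\dots,\varphi_M^0\}\setminus\{0\}$. Then $$\frac1{\sqrt2}\|\gamma^0-\gamma_h\|_{\mathfrak S_2(\mathcal H)}\le\|\Phi^0-\Phi_h^0\|\le\|\gamma^0-\gamma_h\|_{\mathfrak S_2(\mathcal H)}.$$ Moreover, $$\frac1{\sqrt2}\|A^{1/2}(\gamma^0-\gamma_h)\|_{\mathfrak S_2(\mathcal H)}\le\|A^{1/2}(\Phi^0-\Phi_h^0)\|\le\Big(1+\frac{\lambda_M}{4\lambda_m}\|\gamma^0-\gamma_h\|_{\mathfrak S_2(\mathcal H)}^2\Big)^{1/2}\|A^{1/2}(\gamma^0-\gamma_h)\|_{\mathfrak S_2(\mathcal H)},$$ and in particular $$\|A^{1/2}(\Phi^0-\Phi_h^0)\|\le\Big(1+\frac{J\lambda_M}{\lambda_m}\Big)^{1/2}\|A^{1/2}(\gamma^0-\gamma_h)\|_{\mathfrak S_2(\mathcal H)}.$$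
   Context: $\mathcal H$ is a real separable Hilbert space with inner product $(\cdot,\cdot)$ and norm $\|\cdot\|$; $\|B\|_{\mathfrak S_2(\mathcal H)}$ is the Hilbert–Schmidt norm. $A$ is a self-adjoint, positive definite operator on $\mathcal H$ with domain $D(A)$ and compact resolvent; $(\lambda_k)_{k\ge1}$ is the nondecreasing sequence of its (positive) eigenvalues counted with multiplicity, $\lambda_k\to+\infty$, and $(\varphi_k^0)_{k\ge1}$ is an orthonormal basis of $\mathcal H$ with $A\varphi_k^0=\lambda_k\varphi_k^0$. For $s\in\mathbb{R}$, $D(A^s):=\{v\in\mathcal H:\sum_k\lambda_k^{2s}|(v,\varphi_k^0)|^2<\infty\}$ and $A^sv:=\sum_k\lambda_k^s(v,\varphi_k^0)\varphi_k^0$. Let $1\le m\le M$ be integers, $J:=M-m+1$. $V_h\subset D(A^{1/2})$ is a finite-dimensional subspace with $\dim V_h\ge M$. The approximate eigenpairs $(\varphi_{kh},\lambda_{kh})\in V_h\times\mathbb{R}_+$, $1\le k\le\dim V_h$, satisfy $(\varphi_{kh},\varphi_{jh})=\delta_{kj}$, $(A^{1/2}\varphi_{kh},A^{1/2}v_h)=\lambda_{kh}(\varphi_{kh},v_h)$ for all $v_h\in V_h$, and $0<\lambda_{1h}\le\lambda_{2h}\le\cdots$ (counting multiplicities). The density matrices are $\gamma^0v:=\sum_{i=m}^M(v,\varphi_i^0)\varphi_i^0$ and $\gamma_hv:=\sum_{i=m}^M(v,\varphi_{ih})\varphi_{ih}$ for $v\in\mathcal H$. For a $J$-tuple $\Psi=(\psi_m,\dots,\psi_M)$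 in $[D(A^s)]^J$, $\|A^s\Psi\|:=(\sum_{i=m}^M\|A^s\psi_i\|^2)^{1/2}$. $\Phi^0:=(\varphi_m^0,\dots,\varphi_M^0)$, $\Phi_h:=(\varphi_{mh},\dots,\varphi_{Mh})$, and $\Phi_h^0=(\varphi_{mh}^0,\dots,\varphi_{Mh}^0):=U\Phi_h$, where $U$ minimizes $\|U\Phi_h-\Phi^0\|$ over the group $O(J)$ of real orthogonal $J\times J$ matrices (acting by linear combinations of the entries of the tuple); under the non-orthogonality assumption of the claim the minimizer is unique. *)

(* Defs.v *)
From mathcomp Require Import all_boot all_order all_algebra.
From mathcomp Require Export sesquilinear.
From mathcomp Require Import all_classical all_reals all_analysis.
Import Order.TTheory GRing.Theory Num.Theory.
Import numFieldNormedType.Exports.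

Set Implicit Arguments.
Unset Strict Implicit.
Unset Printing Implicit Defensive.

Local Open Scope classical_set_scope.
Local Open Scope ring_scope.

(* Sequences of eigenvalues and eigenvectors are indexed by nat but start at 1:
   the value at 0 is never used. Finite tuples are functions on 'I_n. *)

(* A real Hilbert space is a completeNormedModType R with an inner product
   inducing its norm. *)
Definition hilbert_ip (R : realType) (H : completeNormedModType R)
    (ip : {dot H for @idfun R}) : Prop :=
  forall v, ip v v = `|v| ^+ 2.

Definition separable (T : topologicalType) : Prop :=
  exists2 S : set T, countable S & dense S.

Section operators.
Variables (R : realType) (H : completeNormedModType R).
Variable ip : {dot H for @idfun R}.

(* An unbounded operator is a domain [dom] with a total function [A] whose
   values outside [dom] are irrelevant. *)
Definition linear_on (dom : set H) (A : H -> H) : Prop :=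
  dom 0 /\
  forall (a : R) u v, dom u -> dom v ->
    dom (a *: u + v) /\ A (a *: u + v) = a *: A u + A v.

(* (u, w) is in the graph of the adjoint. *)
Definition adjoint_graph (dom : set H) (A : H -> H) (u w : H) : Prop :=
  forall v, dom v -> ip (A v) u = ip v w.

Definition self_adjoint (dom : set H) (A : H -> H) : Prop :=
  [/\ linear_on dom A, dense dom &
      forall u w, adjoint_graph dom A u w <-> dom u /\ w = A u].

Definition positive_definite (dom : set H) (A : H -> H) : Prop :=
  forall v, dom v -> v != 0 -> 0 < ip (A v) v.

Definition compact_operator (T : H -> H) : Prop :=
  forall B : set H, bounded_set B -> precompact (T @` B).

(* [T] is the inverse of A - z; its linearity follows from that of A. *)
Definition compact_resolvent (dom : set H) (A : H -> H) : Prop :=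
  exists (z : R) (T : H -> H),
    [/\ forall v, dom (T v) /\ A (T v) - z *: T v = v,
        forall u, dom u -> T (A u - z *: u) = u &
        compact_operator T].

Definition orthonormal_basis (e : nat -> H) : Prop :=
  (forall j k, (0 < j)%N -> (0 < k)%N -> ip (e j) (e k) = (j == k)%:R) /\
  (forall v, (fun n => \sum_(1 <= k < n) ip v (e k) *: e k) @ \oo --> v).

Definition eigen_system (dom : set H) (A : H -> H)
    (lam : nat -> R) (phi : nat -> H) : Prop :=
  [/\ orthonormal_basis phi,
      forall k, (0 < k)%N -> dom (phi k) /\ A (phi k) = lam k *: phi k,
      forall k, (0 < k)%N -> 0 < lam k,
      forall j k, (0 < j)%N -> (j <= k)%N -> lam j <= lam k &
      lam @ \oo --> +oo].

Definition dom_pow (lam : nat -> R) (phi : nat -> H) (s : R) : set H :=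
  [set v | (\sum_(1 <= k <oo)
     (lam k `^ (2 * s) * `|ip v (phi k)| ^+ 2)%:E < +oo)%E].

Definition op_pow (lam : nat -> R) (phi : nat -> H) (s : R) (v : H) : H :=
  limn (fun n => \sum_(1 <= k < n) (lam k `^ s * ip v (phi k)) *: phi k).

(* The Hilbert-Schmidt norm computed in the orthonormal basis [e]. *)
Definition hs_norm (e : nat -> H) (B : H -> H) : \bar R :=
  sqrte (\sum_(1 <= k <oo) (`|B (e k)| ^+ 2)%:E).

Definition tuple_span (n : nat) (b : 'I_n -> H) : set H :=
  [set v | exists c : 'I_n -> R, v = \sum_i c i *: b i].

Definition subspace_of_dim (V : set H) (n : nat) : Prop :=
  exists b : 'I_n -> H,
    (forall c : 'I_n -> R, \sum_i c i *: b i = 0 -> forall i, c i = 0) /\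
    V = tuple_span b.

Definition ritz_pairs (lam : nat -> R) (phi : nat -> H) (V : set H) (N : nat)
    (lamh : nat -> R) (phih : nat -> H) : Prop :=
  [/\ forall k, (1 <= k <= N)%N -> V (phih k),
      forall j k, (1 <= j <= N)%N -> (1 <= k <= N)%N ->
        ip (phih k) (phih j) = (k == j)%:R,
      forall k v, (1 <= k <= N)%N -> V v ->
        ip (op_pow lam phi 2^-1 (phih k)) (op_pow lam phi 2^-1 v)
          = lamh k * ip (phih k) v,
      forall k, (1 <= k <= N)%N -> 0 < lamh k &
      forall j k, (1 <= j)%N -> (j <= k <= N)%N -> lamh j <= lamh k].

Definition density (m M : nat) (f : nat -> H) (v : H) : H :=
  \sum_(m <= i < M.+1) ip v (f i) *: f i.

(* The J-tuple (f m, ..., f (m + J - 1)). *)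
Definition subtuple (m J : nat) (f : nat -> H) : 'I_J -> H :=
  fun i => f (m + i)%N.

Definition tuple_norm (J : nat) (Psi : 'I_J -> H) : R :=
  Num.sqrt (\sum_i `|Psi i| ^+ 2).

Definition tuple_act (J : nat) (U : 'M[R]_J) (Psi : 'I_J -> H) : 'I_J -> H :=
  fun i => \sum_j U i j *: Psi j.

Definition orthogonal_mx (J : nat) (U : 'M[R]_J) : Prop := U *m U^T = 1%:M.

Definition best_rotation (J : nat) (Psi Phi : 'I_J -> H) (U : 'M[R]_J) : Prop :=
  orthogonal_mx U /\
  forall W : 'M[R]_J, orthogonal_mx W ->
    tuple_norm (tuple_act U Psi \- Phi) <= tuple_norm (tuple_act W Psi \- Phi).

End operators.

(* Main.v *)
(** Write [p] for the tuple of exact eigenvectors, [q = U Phih] for the rotated one and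
    [G i j = (q i, p j)].  Minimality of [U] says that the trace of [W G] over orthogonal
    [W] is maximal at [W = 1]; testing with reflections and plane rotations shows that [G]
    is positive semidefinite and symmetric.  As [G] is a contraction, [G^2 <= G].
    By Parseval, with [L] the sum of the eigenvalues and [K] that of the Ritz values,
      |A^(1/2)(p - q)|^2 = L + K - 2 sum_i lam_i G_ii,
      |A^(1/2)(gamma^0 - gamma_h)|^2 = L + K - 2 sum_i lam_i (G^2)_ii,
    so the energy upper bound holds even with constant 1.  The lower bound follows from
    [(1 - G)^2 >= 0] and the min-max inequality [K >= L].  The plain norms are the case
    of unit weights. *)
Require Import Defs.
From mathcomp Require Import all_boot all_order all_algebra.
From mathcomp Require Import ring lra.
From mathcomp Require Import all_classical all_reals all_analysis.
Import Order.TTheory GRing.Theory Num.Theory.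
Import numFieldNormedType.Exports.
Local Open Scope classical_set_scope.
Local Open Scope ring_scope.

(** * Matrices whose trace is maximal under orthogonal factors *)

Section TraceMaximal.
Set Implicit Arguments.
Unset Strict Implicit.
Variables (R : realType) (n : nat).
Implicit Types (G W : 'M[R]_n) (x : 'cV[R]_n).

Lemma dot_colE x (y : 'cV[R]_n) : (x^T *m y) 0 0 = \sum_i x i 0 * y i 0.
Proof. by rewrite mxE; apply: eq_bigr => i _; rewrite mxE. Qed.

Lemma dot_colC x (y : 'cV[R]_n) : (x^T *m y) 0 0 = (y^T *m x) 0 0.
Proof. by rewrite !dot_colE; apply: eq_bigr => i _; rewrite mulrC. Qed.

Lemma dot_col_ge0 x : 0 <= (x^T *m x) 0 0.
Proof. by rewrite dot_colE sumr_ge0 // => i _; rewrite -expr2 sqr_ge0. Qed.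

Lemma dot_col_eq0 x : (x^T *m x) 0 0 = 0 -> x = 0.
Proof.
rewrite dot_colE => /eqP; rewrite psumr_eq0 => [|i _]; last first.
  by rewrite -expr2 sqr_ge0.
move=> /allP x0; apply/matrixP => i j; rewrite ord1 mxE.
by have := x0 i (mem_index_enum i); rewrite /= mulf_eq0 orbb => /eqP.
Qed.

(** The Householder reflection along [x]. Since [X *m X = s *: X], the coefficient [2 / s] makes all
    terms in [X] cancel in the square. *)
Lemma orthogonal_reflection x : x != 0 ->
  orthogonal_mx (1%:M - (2 / (x^T *m x) 0 0) *: (x *m x^T)).
Proof.
move=> x0; set s := (x^T *m x) 0 0; set X := x *m x^T.
have s0 : s != 0 by apply: contra x0 => /eqP/dot_col_eq0 ->.
have XT : X^T = X by rewrite /X trmx_mul trmxK.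
have XX : X *m X = s *: X.
  by rewrite /X mulmxA -(mulmxA x) [x^T *m x]mx11_scalar -/s mul_mx_scalar -scalemxAl.
rewrite /orthogonal_mx; have -> : (1%:M - (2 / s) *: X)^T = 1%:M - (2 / s) *: X.
  by apply/matrixP => i j; rewrite -[in RHS]XT !mxE eq_sym.
rewrite mulmxBl mul1mx mulmxBr mulmx1 -scalemxAl -scalemxAr XX !scalerA.
have -> : 2 / s * (2 / s) * s = 2 / s + 2 / s by field.
by rewrite scalerDl; apply/matrixP => i j; rewrite !mxE; ring.
Qed.

(** The rotation in the coordinate plane of [i] and [j]. [D] projects onto that plane and [K]
    generates the rotation, with [K D = D K = K] and [K K = - D]; the product with the transpose is
    then [1 + (c^2 + s^2 - 1) D]. *)
Lemma orthogonal_rotation (i j : 'I_n) (c s : R) : i != j -> c ^+ 2 + s ^+ 2 = 1 ->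
  orthogonal_mx (1%:M + s *: (delta_mx i j - delta_mx j i)
                 + (c - 1) *: (delta_mx i i + delta_mx j j)).
Proof.
move=> ij cs; rewrite /orthogonal_mx.
set K := delta_mx i j - _; set D := delta_mx i i + _.
have ji : (j == i) = false by rewrite eq_sym (negbTE ij).
have Eij : (i == j) = false by rewrite (negbTE ij).
have KT : K^T = - K by rewrite /K linearB /= !trmx_delta opprB.
have DT : D^T = D by rewrite /D linearD /= !trmx_delta.
have DD : D *m D = D.
  by rewrite /D mulmxDl !mulmxDr !mul_delta_mx_cond !eqxx ji Eij !mulr0n !mulr1n addr0 add0r.
have KD : K *m D = K.
  by rewrite /K /D mulmxBl !mulmxDr !mul_delta_mx_cond !eqxx ji Eij !mulr0n !mulr1n addr0 add0r.
have DK : D *m K = K.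
  by rewrite /K /D mulmxDl !mulmxBr !mul_delta_mx_cond !eqxx ji Eij !mulr0n !mulr1n subr0 sub0r.
have KK : K *m K = - D.
  by rewrite /K /D mulmxBl !mulmxBr !mul_delta_mx_cond !eqxx ji Eij !mulr0n !mulr1n subr0 sub0r opprD.
have -> : (1%:M + s *: K + (c - 1) *: D)^T = 1%:M - s *: K + (c - 1) *: D.
  by apply/matrixP => a b; rewrite -scalerN -KT -[in RHS]DT !mxE eq_sym.
rewrite !(mulmxDl, mulmxDr, mul1mx, mulmx1, mulmxN) -!scalemxAl -!scalemxAr.
rewrite ?scalerN ?mulmxN ?mulNmx DD KD DK KK !scalerA.
have -> : s * s = 1 - c ^+ 2 by rewrite -cs; ring.
apply/matrixP => a b; rewrite !mxE; ring.
Qed.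

Variable G : 'M[R]_n.
Hypothesis Gmax : forall W, orthogonal_mx W -> \tr (W *m G) <= \tr G.

(** The reflection along [x] lowers the trace by [2 (x, G x) / |x|^2], which maximality forces to be
    nonnegative. *)
Lemma trace_maximal_psd x : 0 <= (x^T *m G *m x) 0 0.
Proof.
have [-> | x0] := eqVneq x 0; first by rewrite mulmx0 mxE.
have := Gmax (orthogonal_reflection x0); rewrite mulmxBl mul1mx raddfB /=.
rewrite gerBl -scalemxAl mxtraceZ -(mulmxA x) (mxtrace_mulC x) trace_mx11.
rewrite pmulr_rge0 ?divr_gt0 // lt_def dot_col_ge0 andbT.
by apply: contra x0 => /eqP/dot_col_eq0 ->.
Qed.

(** A rotation in the plane of [i] and [j] changes the trace by [s d + (c - 1) t]. For small angles
    the first term is of first order and the second of second order, so [d] must vanish. *)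
Lemma trace_maximal_sym : G^T = G.
Proof.
apply/matrixP => j i; rewrite mxE; have [-> // | ij] := eqVneq i j.
have dlt k l : \tr (delta_mx k l *m G) = G l k.
  rewrite /mxtrace (bigD1 k) //= big1 ?addr0 => [|h /negPf hk]; rewrite mxE.
    rewrite (bigD1 l) //= big1 ?addr0 => [|h /negPf hl].
      by rewrite mxE !eqxx mul1r.
    by rewrite mxE hl andbF mul0r.
  by rewrite big1 // => h' _; rewrite mxE hk mul0r.
have psd k : 0 <= G k k.
  have := trace_maximal_psd (delta_mx k 0).
  by rewrite trmx_delta -rowE -colE !mxE.
set d := G j i - G i j; set t := G i i + G j j.
have t0 : 0 <= t by rewrite addr_ge0.
have rot c s : c ^+ 2 + s ^+ 2 = 1 -> s * d + (c - 1) * t <= 0.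
  move=> cs; have := Gmax (orthogonal_rotation ij cs).
  rewrite !mulmxDl mul1mx !mxtraceD -!scalemxAl !mxtraceZ mulmxBl mulmxDl.
  by rewrite raddfB mxtraceD /= !dlt -/d -/t; lra.
(* z is the tangent of half the rotation angle. *)
have quad (z : R) : 2 * z * d <= 2 * z ^+ 2 * t.
  have q0 : 0 < 1 + z ^+ 2 by rewrite ltr_pwDl // sqr_ge0.
  have := rot ((1 - z ^+ 2) / (1 + z ^+ 2)) (2 * z / (1 + z ^+ 2)).
  rewrite -(ler_pM2r q0) mul0r; set u := (X in X <= 0).
  have -> : u = 2 * z * d - 2 * z ^+ 2 * t by rewrite /u; field; apply: lt0r_neq0.
  by rewrite subr_le0; apply; field; apply: lt0r_neq0.
(* This [z] turns the bound into [2 d^2 (t + 1) <= 2 d^2 t]; adding 1 keeps the denominator positive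
   when [t = 0]. *)
have := quad (d / (t + 1)); have t1 : 0 < (t + 1) ^+ 2 by rewrite exprn_gt0 // ltr_wpDl.
rewrite -(ler_pM2r t1).
have -> : 2 * (d / (t + 1)) * d * (t + 1) ^+ 2 = 2 * d ^+ 2 * (t + 1).
  by field; apply: lt0r_neq0; rewrite ltr_wpDl.
have -> : 2 * (d / (t + 1)) ^+ 2 * t * (t + 1) ^+ 2 = 2 * d ^+ 2 * t.
  by field; apply: lt0r_neq0; rewrite ltr_wpDl.
rewrite mulrDr mulr1 gerDl => d2.
have /eqP : d ^+ 2 = 0 by apply/le_anti; rewrite sqr_ge0 andbT; lra.
by rewrite sqrf_eq0 subr_eq0 => /eqP ->.
Qed.

Hypothesis Gcontr : forall x, ((G *m x)^T *m (G *m x)) 0 0 <= (x^T *m x) 0 0.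

(* With y = Gx, positivity at x - y and (y, Gy) <= |y|^2 give |Gx|^2 <= (x, Gx). *)
Lemma trace_maximal_sqr_le (i : 'I_n) : \sum_j G i j ^+ 2 <= G i i.
Proof.
set x : 'cV[R]_n := delta_mx i 0; set y := G *m x.
have Gii : (x^T *m y) 0 0 = G i i.
  by rewrite /y /x trmx_delta mulmxA -rowE -colE !mxE.
have yy : (y^T *m y) 0 0 = \sum_j G i j ^+ 2.
  rewrite dot_colE; apply: eq_bigr => j _; rewrite /y /x -colE !mxE.
  by rewrite -[in LHS]trace_maximal_sym mxE expr2.
have pos := trace_maximal_psd (x - y).
(* Expanding [|y - G y|^2 >= 0] and using [|G y| <= |y|] yields [(y, G y) <= |y|^2]. *)
have cy := Gcontr y; have sq := dot_col_ge0 (y - G *m y).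
rewrite -mulmxA !(linearB, mulmxBr) /= !mulmxBl !mxE in pos sq.
have E : (x^T *m (G *m y)) 0 0 = (y^T *m y) 0 0.
  by rewrite mulmxA -[in LHS]trace_maximal_sym -trmx_mul.
rewrite -/y in pos.
have C := dot_colC y (G *m y).
rewrite -yy -Gii; move: pos sq cy C E.
rewrite !mxE; lra.
Qed.
End TraceMaximal.

(** * Inner product, orthonormal expansions and Hilbert-Schmidt norms *)

Section InnerProduct.
Set Implicit Arguments.
Unset Strict Implicit.
Variables (R : realType) (H : completeNormedModType R).
Variable ip : {dot H for @idfun R}.
Hypothesis Hip : hilbert_ip ip.

Lemma ipC u v : ip u v = ip v u.
Proof. by rewrite hermC expr0 mul1r. Qed.

Lemma ipZl a u v : ip (a *: u) v = a * ip u v.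
Proof. by rewrite linearZl_LR. Qed.

Lemma ipZr a u v : ip u (a *: v) = a * ip u v.
Proof. by rewrite ipC ipZl ipC. Qed.

Lemma ipDl u v w : ip (u + v) w = ip u w + ip v w.
Proof. exact: linearDl. Qed.

Lemma ipDr u v w : ip u (v + w) = ip u v + ip u w.
Proof. exact: linearDr. Qed.

Lemma ipBl u v w : ip (u - v) w = ip u w - ip v w.
Proof. exact: linearBl. Qed.

Lemma ipBr u v w : ip u (v - w) = ip u v - ip u w.
Proof. exact: linearBr. Qed.

Lemma ip_sum (I : Type) (r : seq I) (x : I -> H) v :
  ip (\sum_(i <- r) x i) v = \sum_(i <- r) ip (x i) v.
Proof. exact: linear_sumlz. Qed.

Lemma normB_ip u v : `|u - v| ^+ 2 = `|u| ^+ 2 + `|v| ^+ 2 - 2 * ip u v.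
Proof. by rewrite -!Hip !ipBl !ipBr (ipC v u); ring. Qed.

(** Polarization reduces the continuity of the inner product to that of the norm. *)
Lemma ip_polar u v : ip u v = (`|u + v| ^+ 2 - `|u - v| ^+ 2) / 4.
Proof.
rewrite -!Hip !ipBl !ipDl !ipBr !ipDr (ipC v u).
by field.
Qed.

Lemma ip_suml (I : finType) (a : I -> R) (x : I -> H) v :
  ip (\sum_i a i *: x i) v = \sum_i a i * ip (x i) v.
Proof. by rewrite ip_sum; apply: eq_bigr => i _; rewrite ipZl. Qed.

Lemma norm_sum_ip (I : finType) (a : I -> R) (x : I -> H) :
  `|\sum_i a i *: x i| ^+ 2 = \sum_i \sum_j a i * a j * ip (x i) (x j).
Proof.
rewrite -Hip ip_suml; apply: eq_bigr => i _.
rewrite ipC ip_suml mulr_sumr; apply: eq_bigr => j _.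
by rewrite mulrA (ipC (x j)).
Qed.

Lemma norm_sum_orthonormal (I : finType) (a : I -> R) (x : I -> H) :
  (forall i j, ip (x i) (x j) = (i == j)%:R) ->
  `|\sum_i a i *: x i| ^+ 2 = \sum_i a i ^+ 2.
Proof.
move=> on; rewrite norm_sum_ip; apply: eq_bigr => i _.
rewrite (bigD1 i) //= big1 ?addr0 => [|j /negPf ji].
  by rewrite on eqxx mulr1.
by rewrite on eq_sym ji mulr0.
Qed.

(** The difference of the two sides is the squared norm of [v] minus its projection. *)
Lemma bessel (I : finType) (x : I -> H) v :
  (forall i j, ip (x i) (x j) = (i == j)%:R) ->
  \sum_i ip v (x i) ^+ 2 <= `|v| ^+ 2.
Proof.
move=> on; have := sqr_ge0 `|v - \sum_i ip v (x i) *: x i|.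
rewrite normB_ip norm_sum_orthonormal // ipC ip_suml.
have -> : \sum_i ip v (x i) * ip (x i) v = \sum_i ip v (x i) ^+ 2.
  by apply: eq_bigr => i _; rewrite (ipC (x i)) expr2.
lra.
Qed.

Lemma ip_cvg (u_ v_ : nat -> H) u v :
  u_ @ \oo --> u -> v_ @ \oo --> v -> (fun n => ip (u_ n) (v_ n) : R) @ \oo --> (ip u v : R).
Proof.
move=> cu cv; rewrite ip_polar.
rewrite [X in X @ _](_ : _ = fun n =>
  (`|u_ n + v_ n| ^+ 2 - `|u_ n - v_ n| ^+ 2) / 4 : R); last first.
  by apply/funext => n; rewrite ip_polar.
have sqr_cvg (w_ : nat -> H) w :
    w_ @ \oo --> w -> (fun n => `|w_ n| ^+ 2 : R) @ \oo --> (`|w| ^+ 2 : R).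
  by move=> cw; apply: cvgM; apply: cvg_norm.
apply: cvgMr_tmp.
apply: cvgB.
  by apply: (sqr_cvg (u_ + v_)); apply: cvgD.
by apply: (sqr_cvg (u_ - v_)); apply: cvgB.
Qed.

Lemma parseval (e : nat -> H) u v : orthonormal_basis ip e ->
  (fun n => \sum_(1 <= k < n) ip u (e k) * ip v (e k) : R) @ \oo --> (ip u v : R).
Proof.
move=> [_ exp]; rewrite [X in X @ _](_ : _ =
  fun n => ip (\sum_(1 <= k < n) ip u (e k) *: e k) v : R); last first.
  apply/funext => n; rewrite ip_sum; apply: eq_bigr => k _.
  by rewrite ipZl (ipC _ v).
by apply: (ip_cvg (v_ := fun=> v)) (exp u) _; exact: cvg_cst.
Qed.

(** Riesz-Fischer: by Pythagoras, blocks of the vector series have as squared norms the blocks of a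
    bounded series of nonnegative terms, so the Cauchy criterion carries over and completeness
    concludes. *)
Lemma orthonormal_series_cvg (f : nat -> H) (a : nat -> R) (C : R) :
  (forall j k, (0 < j)%N -> (0 < k)%N -> ip (f j) (f k) = (j == k)%:R) ->
  (forall n, \sum_(1 <= k < n) a k ^+ 2 <= C) ->
  cvgn (fun n => \sum_(1 <= k < n) a k *: f k).
Proof.
move=> on bnd.
(* [series] starts at index 0, where nothing is known of [f]; a zero term is put there. *)
have shift (V : zmodType) (g : nat -> V) :
    (fun n => \sum_(1 <= k < n) g k) = series (fun k => if k is 0 then 0 else g k).
  apply/funext => -[|n]; rewrite /series /=; first by rewrite !big_geq.
  by rewrite [RHS]big_ltn // add0r big_nat [RHS]big_nat; apply: eq_bigr => -[].
rewrite shift; apply/cauchy_cvgP/cauchy_seriesP => eps eps0.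
set w := fun k => if k is 0 then 0 else a k *: f k.
set v := fun k => if k is 0 then 0 else a k ^+ 2.
have pyth m n : `|\sum_(m <= k < n) w k| ^+ 2 = \sum_(m <= k < n) v k.
  elim: n => [|n IH]; first by rewrite !big_geq // normr0 expr0n.
  have [mn|nm] := leqP m n; last by rewrite !big_geq // normr0 expr0n.
  rewrite !big_nat_recr //= -IH -!Hip ipDl !ipDr.
  have orth : ip (\sum_(m <= k < n) w k) (w n) = 0.
    rewrite ip_sum big_nat big1 // => k /andP[_ kn].
    case: k n kn {IH mn} => [|k] [|n] //= kn; rewrite ?linear0l //.
    by rewrite ipZl ipZr on // (ltn_eqF kn) !mulr0.
  rewrite (ipC (w n)) orth.
  have -> : ip (w n) (w n) = v n; last by rewrite addr0 add0r.
  by case: n {IH mn orth} => [|n] /=; rewrite ?linear0l // ipZl ipZr on // eqxx mulr1.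
have /cauchy_cvgP/cauchy_seriesP : cvgn (series v).
  rewrite -shift; apply: nondecreasing_is_cvgn => [m n mn|]; last first.
    by exists C => _ [n _ <-].
  rewrite -(subnKC mn) -subr_ge0; case: m {mn} => [|m].
    by rewrite (big_geq (m := 1) (n := 0)) // subr0 sumr_ge0 // => k _; exact: sqr_ge0.
  rewrite (big_cat_nat (n := m.+1)) ?leq_addr //= addrC addrK.
  by apply: sumr_ge0 => k _; exact: sqr_ge0.
(* [pyth] compares squares, so the tolerance [eps] becomes [eps ^+ 2]. *)
move=> /(_ (eps ^+ 2)); rewrite exprn_gt0 // => /(_ isT).
apply: filterS => -[m n] /=; rewrite -pyth ger0_norm ?sqr_ge0 //.
by rewrite ltr_pXn2r ?nnegrE // ltW.
Qed.

Lemma cvg_hs_norm (e : nat -> H) (B : H -> H) (l : R) :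
  (fun n => \sum_(1 <= k < n) `|B (e k)| ^+ 2) @ \oo --> l ->
  hs_norm e B = (Num.sqrt l)%:E.
Proof.
move=> cl; rewrite /hs_norm.
under eq_fun do rewrite sumEFin.
have -> : limn (fun n => (\sum_(1 <= k < n) `|B (e k)| ^+ 2)%:E) = l%:E.
  rewrite [LHS](_ : _ = (limn (fun n => \sum_(1 <= k < n) `|B (e k)| ^+ 2))%:E).
    by rewrite (cvg_lim _ cl).
  by rewrite -EFin_lim //; apply/cvg_ex; exists l.
by [].
Qed.

(** Expanding the squared norm at [e k] and summing over [k] by Parseval pairs the Gram matrices of
    [a] and [b]; the basis [e] disappears. *)
Lemma hs_norm_finite_rank (e : nat -> H) (I : finType) (a b : I -> H) :
  orthonormal_basis ip e ->
  hs_norm e (fun v => \sum_i ip v (a i) *: b i) =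
    (Num.sqrt (\sum_i \sum_j ip (a i) (a j) * ip (b i) (b j)))%:E.
Proof.
move=> He; apply: cvg_hs_norm.
rewrite (_ : (fun n => _) = fun n => \sum_i \sum_j
   (\sum_(1 <= k < n) ip (a i) (e k) * ip (a j) (e k)) * ip (b i) (b j)).
  apply: cvg_big => [|i _]; first exact: add_continuous.
  apply: cvg_big => [|j _]; first exact: add_continuous.
  by apply: cvgMr_tmp; exact: parseval.
apply/funext => n.
under eq_bigr do rewrite norm_sum_ip.
rewrite exchange_big; apply: eq_bigr => i _.
rewrite exchange_big; apply: eq_bigr => j _.
by rewrite mulr_suml; apply: eq_bigr => k _; rewrite !(ipC (e k)).
Qed.

End InnerProduct.

(** * Powers of the operator and the min-max inequality for Ritz values *)

Section SpectralPower.
Set Implicit Arguments.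
Unset Strict Implicit.
Variables (R : realType) (H : completeNormedModType R).
Variable ip : {dot H for @idfun R}.
Hypothesis Hip : hilbert_ip ip.
Variables (lam : nat -> R) (phi : nat -> H).
Hypothesis onb : orthonormal_basis ip phi.

(** [op_pow] is a [limn], which has a default value on divergent sequences; its algebraic rules are
    therefore proved under this condition. *)
Definition op_pow_cvg (s : R) (v : H) : Prop :=
  cvgn (fun n => \sum_(1 <= k < n) (lam k `^ s * ip v (phi k)) *: phi k).

(** Stated as a limit so that it yields both the convergence condition for the combination and the
    value of [op_pow] there. *)
Lemma op_pow_cvg_sum s (I : finType) (c : I -> R) (x : I -> H) :
  (forall i, op_pow_cvg s (x i)) ->
  (fun n => \sum_(1 <= k < n) (lam k `^ s * ip (\sum_i c i *: x i) (phi k)) *: phi k)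
    @ \oo --> \sum_i c i *: op_pow ip lam phi s (x i).
Proof.
move=> cx; rewrite [X in X @ _](_ : _ = fun n => \sum_i
   c i *: \sum_(1 <= k < n) (lam k `^ s * ip (x i) (phi k)) *: phi k).
  apply: cvg_big => [|i _]; first exact: add_continuous.
  by apply: cvgZl_tmp; exact: cx.
apply/funext => n; under [RHS]eq_bigr do rewrite scaler_sumr.
rewrite exchange_big; apply: eq_bigr => k _.
rewrite ip_suml mulr_sumr scaler_suml; apply: eq_bigr => i _.
by rewrite scalerA mulrCA.
Qed.

Lemma op_pow_sum s (I : finType) (c : I -> R) (x : I -> H) :
  (forall i, op_pow_cvg s (x i)) ->
  op_pow ip lam phi s (\sum_i c i *: x i) = \sum_i c i *: op_pow ip lam phi s (x i).
Proof. by move=> cx; apply: cvg_lim => //; exact: op_pow_cvg_sum. Qed.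

Lemma op_powB s u v : op_pow_cvg s u -> op_pow_cvg s v ->
  op_pow ip lam phi s (u - v) = op_pow ip lam phi s u - op_pow ip lam phi s v.
Proof.
move=> cu cv; apply: cvg_lim => //; rewrite [X in X @ _](_ : _ =
    (fun n => \sum_(1 <= k < n) (lam k `^ s * ip u (phi k)) *: phi k) -
    (fun n => \sum_(1 <= k < n) (lam k `^ s * ip v (phi k)) *: phi k)).
  by apply: cvgB; [exact: cu|exact: cv].
apply/funext => n; rewrite !fctE -sumrB; apply: eq_bigr => k _.
by rewrite ipBl mulrBr scalerBl.
Qed.

Lemma op_pow_basis_cvg s j : (0 < j)%N ->
  (fun n => \sum_(1 <= k < n) (lam k `^ s * ip (phi j) (phi k)) *: phi k)
    @ \oo --> lam j `^ s *: phi j.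
Proof.
move=> j0; apply: cvg_near_cst; exists j.+1 => // n /= jn.
rewrite (bigD1_seq j) ?iota_uniq //=; last by rewrite mem_index_iota j0.
rewrite (onb.1 _ _ j0 j0) eqxx mulr1 big1_seq ?addr0 // => k /andP[kj].
rewrite mem_index_iota => /andP[k0 _].
by rewrite (onb.1 _ _ j0 k0) eq_sym (negPf kj) mulr0 scale0r.
Qed.

Lemma op_pow_basis s j : (0 < j)%N ->
  op_pow ip lam phi s (phi j) = lam j `^ s *: phi j.
Proof. by move=> j0; apply: cvg_lim => //; exact: op_pow_basis_cvg. Qed.

Lemma op_pow_basis_is_cvg s j : (0 < j)%N -> op_pow_cvg s (phi j).
Proof. by move=> j0; apply/cvg_ex; eexists; exact: op_pow_basis_cvg. Qed.

Lemma sqr_powR (a s : R) : (a `^ s) ^+ 2 = a `^ (2 * s).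
Proof. by rewrite mulrC powRrM powR_mulrn // powR_ge0. Qed.

(** Finiteness of the defining series bounds the squared coefficients, so Riesz-Fischer applies. *)
Lemma dom_pow_cvg s v : dom_pow ip lam phi s v -> op_pow_cvg s v.
Proof.
rewrite /dom_pow /=; set T := (X in (X < _)%E) => Tfin.
have T0 : (0 <= T)%E.
  by apply: nneseries_ge0 => k _ _; rewrite lee_fin mulr_ge0 ?powR_ge0 ?sqr_ge0.
apply: (orthonormal_series_cvg Hip (C := fine T) onb.1) => n.
rewrite -lee_fin fineK ?ge0_fin_numE // -sumEFin.
under eq_bigr do rewrite exprMn sqr_powR -(@real_normK _ (ip _ _)) ?num_real //.
by apply: nneseries_lim_ge => k _ _; rewrite lee_fin mulr_ge0 ?powR_ge0 ?sqr_ge0.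
Qed.

(** Pairing the partial sums with [phi j] gives a stationary sequence, whose limit is also found by
    continuity of the inner product. *)
Lemma ip_op_pow s v j : op_pow_cvg s v -> (0 < j)%N ->
  ip (op_pow ip lam phi s v) (phi j) = lam j `^ s * ip v (phi j).
Proof.
move=> cv j0; set w := fun n => \sum_(1 <= k < n) (lam k `^ s * ip v (phi k)) *: phi k.
have lim1 : (fun n => ip (w n) (phi j) : R) @ \oo -->
    (ip (op_pow ip lam phi s v) (phi j) : R).
  by apply: (ip_cvg Hip (v_ := fun=> phi j)); [exact: cv|exact: cvg_cst].
have lim2 : (fun n => ip (w n) (phi j) : R) @ \oo --> lam j `^ s * ip v (phi j).
  apply: cvg_near_cst; exists j.+1 => // n /= jn.
  rewrite ip_sum (bigD1_seq j) ?iota_uniq //=; last by rewrite mem_index_iota j0.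
  rewrite ipZl (onb.1 _ _ j0 j0) eqxx mulr1 big1_seq ?addr0 // => k /andP[kj].
  rewrite mem_index_iota => /andP[k0 _].
  by rewrite ipZl (onb.1 _ _ k0 j0) (negPf kj) mulr0.
exact: cvg_unique lim1 lim2.
Qed.

Hypothesis lam_gt0 : forall k, (0 < k)%N -> 0 < lam k.
Hypothesis lam_mono : forall j k, (0 < j)%N -> (j <= k)%N -> lam j <= lam k.

(** By Parseval the energy is the sum of [lam j * ip v (phi j) ^+ 2]; the terms with [j < k] vanish
    and in the others [lam j] is at least [lam k]. *)
Lemma energy_ge v k : op_pow_cvg 2^-1 v -> (0 < k)%N ->
  (forall j, (0 < j < k)%N -> ip v (phi j) = 0) ->
  lam k * `|v| ^+ 2 <= `|op_pow ip lam phi 2^-1 v| ^+ 2.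
Proof.
move=> cv k0 orth.
set w := op_pow ip lam phi 2^-1 v.
have l2 : (fun n => \sum_(1 <= j < n) ip w (phi j) * ip w (phi j) : R) @ \oo --> `|w| ^+ 2.
  by rewrite -Hip; exact: parseval.
have l3 : (fun n => lam k * (\sum_(1 <= j < n) ip v (phi j) * ip v (phi j)) : R)
    @ \oo --> lam k * `|v| ^+ 2.
  by apply: cvgMl_tmp; rewrite -Hip; exact: parseval.
apply: ler_cvg_to l3 l2 _; near=> n.
rewrite mulr_sumr; apply: ler_sum_nat => j /andP[j0 _].
rewrite /w ip_op_pow // -!expr2 exprMn sqr_powR divff ?pnatr_eq0 // powRr1 ?(ltW (lam_gt0 j0)) //.
have [jk|kj] := ltnP j k; first by rewrite orth ?j0 // expr0n /= !mulr0.
by rewrite ler_wpM2r ?sqr_ge0 // lam_mono.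
Unshelve. all: by end_near.
Qed.

(* Courant-Fischer: the span of the first k Ritz vectors contains a nonzero vector
   orthogonal to the first k - 1 eigenvectors. *)
Lemma ritz_value_ge (V : set H) N (lamh : nat -> R) (phih : nat -> H) k :
  V `<=` dom_pow ip lam phi 2^-1 ->
  ritz_pairs ip lam phi V N lamh phih -> (1 <= k <= N)%N -> lam k <= lamh k.
Proof.
move=> VD [inV on eigh _ mono]; case: k => [//|k] /= kN.
have idx (i : 'I_k.+1) : (1 <= i.+1 <= N)%N.
  by rewrite /= (leq_trans _ kN) // ltnS -ltnS.
(* With [k] shifted down by one, [A] has one row more than columns; a nonzero [c] with [c *m A = 0]
   gives the coefficients of the required combination. *)
pose A : 'M[R]_(k.+1, k) := \matrix_(i, j) ip (phih i.+1) (phi j.+1).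
have ker0 : kermx A != 0.
  by rewrite kermx_eq0 /row_free neq_ltn ltnS rank_leq_col.
pose c := nz_row (kermx A).
have c0 : c != 0 by rewrite nz_row_eq0.
have cA : c *m A = 0 by apply/sub_kermxP; exact: nz_row_sub.
pose x (i : 'I_k.+1) := phih i.+1; pose v := \sum_i c 0 i *: x i.
have cx i : op_pow_cvg 2^-1 (x i) by apply/dom_pow_cvg/VD/inV/idx.
have normv : `|v| ^+ 2 = \sum_i c 0 i ^+ 2.
  by apply: norm_sum_orthonormal => // i j; rewrite /x on ?idx // eqSS.
have v0 : 0 < `|v| ^+ 2.
  rewrite lt_def sqr_ge0 andbT normv psumr_eq0 => [|i _]; last exact: sqr_ge0.
  apply: contra c0 => /allP cz; apply/eqP/matrixP => i j; rewrite ord1 mxE.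
  by have := cz j (mem_index_enum j); rewrite /= sqrf_eq0 => /eqP.
rewrite -(ler_pM2r v0).
apply: le_trans (energy_ge (v := v) _ _ _) _ => //.
- by apply/cvg_ex; eexists; exact: op_pow_cvg_sum.
- move=> [//|j] /= jk; have := congr1 (fun B : 'rV[R]_k => B 0 (Ordinal (jk : (j < k)%N))) cA.
  rewrite !mxE => E; rewrite /v ip_suml -[RHS]E; apply: eq_bigr => i _.
  by rewrite mxE.
(* The energy form is diagonal on Ritz vectors, so the energy of [v] is a sum of [c 0 i ^+ 2]
   weighted by Ritz values, the last of which is the largest. *)
rewrite op_pow_sum // (norm_sum_ip Hip) normv mulr_sumr; apply: ler_sum => i _.
rewrite (bigD1 i) //= big1 ?addr0 => [|j /negPf ji].
  rewrite (eigh _ _ (idx i) (inV _ (idx i))) (on _ _ (idx i) (idx i)) eqxx mulr1 -expr2 mulrC.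
  by rewrite ler_wpM2r ?sqr_ge0 // mono // ltnS -ltnS ltn_ord.
have ij : (i.+1 == j.+1) = false by rewrite eqSS eq_sym; exact: ji.
by rewrite (eigh _ _ (idx i) (inV _ (idx j))) (on _ _ (idx j) (idx i)) ij !mulr0.
Qed.

End SpectralPower.

(** * Orthogonal changes of tuples and the overlap matrix of the best rotation *)

Section Overlap.
Set Implicit Arguments.
Unset Strict Implicit.
Variables (R : realType) (H : completeNormedModType R).
Variable ip : {dot H for @idfun R}.
Hypothesis Hip : hilbert_ip ip.
Variable n : nat.
Implicit Types (U W : 'M[R]_n) (p q : 'I_n -> H).

Definition orthonormal_tuple p : Prop := forall i j, ip (p i) (p j) = (i == j)%:R.

Lemma orthogonal_row U i j : orthogonal_mx U -> \sum_k U i k * U j k = (i == j)%:R.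
Proof.
move=> /matrixP/(_ i j); rewrite !mxE => <-.
by apply: eq_bigr => k _; rewrite mxE.
Qed.

Lemma orthogonal_col U i j : orthogonal_mx U -> \sum_k U k i * U k j = (i == j)%:R.
Proof.
move=> /mulmx1C/matrixP/(_ i j); rewrite !mxE => <-.
by apply: eq_bigr => k _; rewrite mxE.
Qed.

(** Summing over [i] first leaves the columns of [U], which are orthonormal. Module values serve
    both sums of squared norms, with [V := R^o], and the vectors of a projection. *)
Lemma orthogonal_trace U (V : lmodType R) (X : 'I_n -> 'I_n -> V) : orthogonal_mx U ->
  \sum_i \sum_j \sum_l (U i j * U i l) *: X j l = \sum_j X j j.
Proof.
move=> oU; rewrite exchange_big; apply: eq_bigr => j _ /=.
rewrite exchange_big (bigD1 j) //= [X in _ + X]big1 ?addr0 => [|l /negPf lj].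
  by rewrite -scaler_suml orthogonal_col // eqxx scale1r.
by rewrite -scaler_suml orthogonal_col // eq_sym lj scale0r.
Qed.

Lemma tuple_act_mul W U p : tuple_act (W *m U) p = tuple_act W (tuple_act U p).
Proof.
apply/funext => i; rewrite /tuple_act; under [RHS]eq_bigr do rewrite scaler_sumr.
rewrite exchange_big; apply: eq_bigr => j _ /=.
by rewrite mxE scaler_suml; apply: eq_bigr => k _; rewrite scalerA.
Qed.

Lemma orthogonal_mxM W U : orthogonal_mx W -> orthogonal_mx U -> orthogonal_mx (W *m U).
Proof.
rewrite /orthogonal_mx trmx_mul => oW oU.
by rewrite mulmxA -(mulmxA W) oU mulmx1.
Qed.

Lemma tuple_act_orthonormal U p : orthogonal_mx U -> orthonormal_tuple p ->
  orthonormal_tuple (tuple_act U p).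
Proof.
move=> oU op i j; rewrite -(orthogonal_row i j oU) /tuple_act ip_suml.
apply: eq_bigr => k _; rewrite ipC ip_suml (bigD1 k) //= big1 ?addr0 => [|l /negPf lk].
  by rewrite op eqxx mulr1.
by rewrite op lk mulr0.
Qed.

(** Since [p] is arbitrary, this also covers the images of a tuple under [A^(1/2)]. *)
Lemma sum_norm_tuple_act U p : orthogonal_mx U ->
  \sum_i `|tuple_act U p i| ^+ 2 = \sum_i `|p i| ^+ 2.
Proof.
move=> oU; transitivity (\sum_i ip (p i) (p i)); last by apply: eq_bigr => i _.
rewrite -[RHS](@orthogonal_trace U R^o (fun j l => ip (p j) (p l)) oU).
by apply: eq_bigr => i _; rewrite /tuple_act (norm_sum_ip Hip).
Qed.

(** This allows the discrete density matrix to be written with the rotated Ritz vectors. *)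
Lemma projection_tuple_act U p v : orthogonal_mx U ->
  \sum_i ip v (tuple_act U p i) *: tuple_act U p i = \sum_i ip v (p i) *: p i.
Proof.
move=> oU; rewrite -[RHS](orthogonal_trace (fun j l => ip v (p j) *: p l) oU).
apply: eq_bigr => i _; rewrite /tuple_act ipC ip_suml scaler_suml.
apply: eq_bigr => j _; rewrite scaler_sumr; apply: eq_bigr => l _.
by rewrite !scalerA ipC; congr (_ *: _); ring.
Qed.

Lemma orthonormal_norm p i : orthonormal_tuple p -> `|p i| ^+ 2 = 1.
Proof. by move=> op; rewrite -Hip op eqxx. Qed.

(** Only the trace of the overlap matrix varies, so minimizing the distance amounts to maximizing
    that trace. *)
Lemma sum_norm_diff p q : orthonormal_tuple p -> orthonormal_tuple q ->
  \sum_i `|q i - p i| ^+ 2 = n%:R + n%:R - 2 * \sum_i ip (q i) (p i).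
Proof.
move=> op oq; rewrite mulr_sumr.
rewrite (eq_bigr (fun i => 1 + 1 - 2 * ip (q i) (p i))) => [|i _].
  by rewrite sumrB big_split /= !sumr_const card_ord.
by rewrite (normB_ip Hip) !orthonormal_norm.
Qed.

Variables (p q0 : 'I_n -> H) (U : 'M[R]_n).
Hypotheses (op : orthonormal_tuple p) (oq0 : orthonormal_tuple q0).
Hypothesis best : best_rotation q0 p U.

Let q := tuple_act U q0.
Let oq : orthonormal_tuple q := tuple_act_orthonormal best.1 oq0.
Let G : 'M[R]_n := \matrix_(i, j) ip (q i) (p j).

(** [W *m U] competes with [U] in the minimization, and its overlap matrix is [W *m G]. *)
Lemma overlap_trace_max W : orthogonal_mx W -> \tr (W *m G) <= \tr G.
Proof.
move=> oW; have := best.2 _ (orthogonal_mxM oW best.1).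
rewrite tuple_act_mul -/q /tuple_norm ler_sqrt; last by rewrite sumr_ge0.
rewrite !sum_norm_diff //; last exact: tuple_act_orthonormal.
have -> : \tr G = \sum_i ip (q i) (p i) by apply: eq_bigr => i _; rewrite mxE.
have -> : \tr (W *m G) = \sum_i ip (tuple_act W q i) (p i).
  apply: eq_bigr => i _; rewrite mxE /tuple_act ip_suml.
  by apply: eq_bigr => j _; rewrite mxE.
lra.
Qed.

(** [G *m x] lists the coefficients along [q] of the combination of [p] with coefficients [x];
    Bessel bounds them. *)
Lemma overlap_contraction (x : 'cV[R]_n) :
  ((G *m x)^T *m (G *m x)) 0 0 <= (x^T *m x) 0 0.
Proof.
rewrite !dot_colE; pose v := \sum_j x j 0 *: p j.
have -> : \sum_i x i 0 * x i 0 = `|v| ^+ 2.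
  by rewrite (norm_sum_orthonormal Hip) //; apply: eq_bigr => i _; rewrite expr2.
apply: le_trans (bessel Hip v oq); apply: ler_sum => i _.
rewrite -expr2; suff -> : (G *m x) i 0 = ip v (q i) by [].
by rewrite mxE ip_suml; apply: eq_bigr => j _; rewrite mxE mulrC ipC.
Qed.

Lemma overlap_sym i j : ip (q i) (p j) = ip (q j) (p i).
Proof.
by have /matrixP/(_ j i) := trace_maximal_sym overlap_trace_max; rewrite !mxE.
Qed.

Lemma overlap_sqr_le i : \sum_j ip (p i) (q j) ^+ 2 <= ip (q i) (p i).
Proof.
have := trace_maximal_sqr_le overlap_trace_max overlap_contraction i.
rewrite mxE; congr (_ <= _); apply: eq_bigr => j _.
by rewrite mxE overlap_sym ipC.
Qed.

(** By symmetry of [G] this is the diagonal entry of [(1 - G)^2]: the square of [1 - G i i] plus the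
    squares of the off-diagonal entries. *)
Lemma overlap_defect_ge0 i : 0 <= 1 - 2 * ip (q i) (p i) + \sum_j ip (p i) (q j) ^+ 2.
Proof.
rewrite (bigD1 i) //= (ipC _ (p i)).
have := sqr_ge0 (1 - ip (q i) (p i)).
have : 0 <= \sum_(j | j != i) ip (p i) (q j) ^+ 2 by rewrite sumr_ge0 // => j _; exact: sqr_ge0.
lra.
Qed.

(* The weights are 1 for the plain norms and the eigenvalues for the energy norms. *)
Lemma overlap_estimates (w : 'I_n -> R) (K : R) :
  (forall i, 0 <= w i) -> \sum_i w i <= K ->
  let d := \sum_i w i + K - 2 * \sum_i w i * ip (q i) (p i) in
  let g := \sum_i w i + K - 2 * \sum_i \sum_j w i * ip (p i) (q j) ^+ 2 in
  [/\ g <= 2 * d & d <= g].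
Proof.
move=> w0 wK; split.
  (* [2 * d - g] equals [K - \sum_i w i] plus twice this sum. *)
  have : 0 <= \sum_i w i * (1 - 2 * ip (q i) (p i) + \sum_j ip (p i) (q j) ^+ 2).
    by apply: sumr_ge0 => i _; rewrite mulr_ge0 // overlap_defect_ge0.
  have -> : \sum_i w i * (1 - 2 * ip (q i) (p i) + \sum_j ip (p i) (q j) ^+ 2) =
      \sum_i w i - 2 * (\sum_i w i * ip (q i) (p i))
      + \sum_i \sum_j w i * ip (p i) (q j) ^+ 2.
    rewrite mulr_sumr -sumrB -big_split; apply: eq_bigr => i _ /=.
    by rewrite -mulr_sumr; ring.
  move: wK; lra.
(* [g - d] is twice the difference of these two sums. *)
have : \sum_i \sum_j w i * ip (p i) (q j) ^+ 2 <= \sum_i w i * ip (q i) (p i).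
  by apply: ler_sum => i _; rewrite -mulr_sumr ler_wpM2l // overlap_sqr_le.
lra.
Qed.

End Overlap.

(** * Hilbert-Schmidt norm of a difference of finite-rank operators *)

Section DensityDifference.
Set Implicit Arguments.
Unset Strict Implicit.
Variables (R : realType) (H : completeNormedModType R).
Variable ip : {dot H for @idfun R}.
Hypothesis Hip : hilbert_ip ip.
Variable n : nat.

(** The disjoint sum of indices turns a difference of two finite sums into a single one, to which
    [hs_norm_finite_rank] applies. *)
Definition tuple_pair (x y : 'I_n -> H) (s : 'I_n + 'I_n) : H :=
  match s with inl i => x i | inr i => y i end.

(* The sign is put on the functionals, so that the vectors can be mapped by A^(1/2). *)
Lemma finite_rank_diffE (a b c d : 'I_n -> H) v :
  \sum_i ip v (a i) *: b i - \sum_i ip v (c i) *: d i =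
  \sum_s ip v (tuple_pair a (fun i => - c i) s) *: tuple_pair b d s.
Proof.
rewrite big_sumType /= -sumrN; congr (_ + _); apply: eq_bigr => i _.
by rewrite -scaleNr -[- c i]scaleN1r ipZr mulN1r.
Qed.

(** The double sum splits into four blocks: orthonormality of [a] and of [c] reduces the diagonal
    blocks, and the two cross blocks coincide. [b] and [d] stay arbitrary so that they can be images
    under [A^(1/2)]. *)
Lemma hs_norm_diff (e : nat -> H) (a b c d : 'I_n -> H) : orthonormal_basis ip e ->
  orthonormal_tuple ip a -> orthonormal_tuple ip c ->
  hs_norm e (fun v => \sum_i ip v (a i) *: b i - \sum_i ip v (c i) *: d i) =
  (Num.sqrt (\sum_i `|b i| ^+ 2 + \sum_i `|d i| ^+ 2 -
     2 * \sum_i \sum_j ip (a i) (c j) * ip (b i) (d j)))%:E.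
Proof.
move=> He oa oc; under eq_fun do rewrite finite_rank_diffE.
rewrite (hs_norm_finite_rank Hip) //; congr (Num.sqrt _)%:E.
have ipNN u v : ip (- u) (- v) = ip u v.
  by rewrite -[- u]scaleN1r -[- v]scaleN1r ipZl ipZr; ring.
have ipNl u v : ip (- u) v = - ip u v by rewrite -scaleN1r ipZl mulN1r.
have ipNr u v : ip u (- v) = - ip u v by rewrite -scaleN1r ipZr mulN1r.
have diag (x y : 'I_n -> H) : orthonormal_tuple ip x ->
    \sum_i \sum_j ip (x i) (x j) * ip (y i) (y j) = \sum_i `|y i| ^+ 2.
  move=> ox; apply: eq_bigr => i _.
  rewrite (bigD1 i) //= big1 ?addr0 => [|j /negPf ji].
    by rewrite ox eqxx mul1r Hip.
  by rewrite ox eq_sym ji mul0r.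
rewrite big_sumType /=; under eq_bigr do rewrite big_sumType /=.
under [X in _ + X]eq_bigr do rewrite big_sumType /=.
rewrite !big_split /= diag //.
have -> : \sum_i \sum_j ip (- c i) (- c j) * ip (d i) (d j) =
    \sum_i `|d i| ^+ 2.
  by rewrite -(diag c) //; do 2 (apply: eq_bigr => ? _); rewrite ipNN.
have -> : \sum_i \sum_j ip (a i) (- c j) * ip (b i) (d j) =
    - \sum_i \sum_j ip (a i) (c j) * ip (b i) (d j).
  by rewrite -sumrN; apply: eq_bigr => i _; rewrite -sumrN; apply: eq_bigr => j _;
     rewrite ipNr mulNr.
have -> : \sum_i \sum_j ip (- c i) (a j) * ip (d i) (b j) =
    - \sum_i \sum_j ip (a i) (c j) * ip (b i) (d j).
  rewrite exchange_big -sumrN; apply: eq_bigr => i _; rewrite -sumrN.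
  by apply: eq_bigr => j _; rewrite ipNl mulNr (ipC _ (a i)) (ipC _ (b i)).
ring.
Qed.

End DensityDifference.

(** * Assembly of the estimates for the density matrices *)

Lemma densityE (R : realType) (H : completeNormedModType R)
    (ip : {dot H for @idfun R}) (m M : nat) (f : nat -> H) v : (m <= M)%N ->
  density ip m M f v =
  \sum_(i < M - m + 1) ip v (subtuple m f i) *: subtuple m f i.
Proof.
move=> mM; rewrite /density -{1}[m]add0n big_addn subSn // -addn1 big_mkord.
by apply: eq_bigr => i _; rewrite /subtuple addnC.
Qed.

Lemma sqrt_estimate (R : realType) (g d : R) : 0 <= d -> g <= 2 * d ->
  (Num.sqrt 2)^-1 * Num.sqrt g <= Num.sqrt d.
Proof.
move=> d0 gd; rewrite mulrC ler_pdivrMr ?sqrtr_gt0 // -sqrtrM // ler_sqrt ?mulr_ge0 //.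
by rewrite mulrC.
Qed.

Theorem lemma3p3 (R : realType) (H : completeNormedModType R)
    (ip : {dot H for @idfun R}) (Hip : hilbert_ip ip) (Hsep : separable H)
    (dom : set H) (A : H -> H)
    (Asa : self_adjoint ip dom A) (Apos : positive_definite ip dom A)
    (Acr : compact_resolvent dom A)
    (lam : nat -> R) (phi : nat -> H)
    (Heig : eigen_system ip dom A lam phi)
    (m M : nat) (Hm : (1 <= m)%N) (HmM : (m <= M)%N)
    (Vh : set H) (N : nat) (HdimV : subspace_of_dim Vh N) (HMN : (M <= N)%N)
    (HVh : Vh `<=` dom_pow ip lam phi 2^-1)
    (lamh : nat -> R) (phih : nat -> H)
    (Hritz : ritz_pairs ip lam phi Vh N lamh phih)
    (Hgapl : (1 < m)%N -> lam m.-1 < lam m)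
    (Hgapr : lam M < lam M.+1)
    (Hno : forall v, tuple_span (subtuple m (J := M - m + 1) phi) v -> v != 0 ->
       `|density ip m M phih v| != 0)
    (U : 'M[R]_(M - m + 1))
    (HU : best_rotation (subtuple m phih) (subtuple m phi) U)
    (e : nat -> H) (He : orthonormal_basis ip e) :
  let J := (M - m + 1)%N in
  let Phi0 : 'I_J -> H := subtuple m phi in
  let Phih0 : 'I_J -> H := tuple_act U (subtuple m phih) in
  let sqrtA := op_pow ip lam phi 2^-1 in
  let dgamma v := density ip m M phi v - density ip m M phih v in
  let err := tuple_norm (Phi0 \- Phih0) in
  let errA := tuple_norm (fun i => sqrtA (Phi0 i - Phih0 i)) in
  [/\ (((Num.sqrt 2)^-1)%:E * hs_norm e dgamma <= err%:E
        /\ err%:E <= hs_norm e dgamma)%E,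
      (((Num.sqrt 2)^-1)%:E * hs_norm e (sqrtA \o dgamma) <= errA%:E
        /\ errA%:E <= sqrte (1 + (lam M / (4 * lam m))%:E * hs_norm e dgamma ^+ 2)
                      * hs_norm e (sqrtA \o dgamma))%E &
      (errA%:E <= (Num.sqrt (1 + J%:R * lam M / lam m))%:E
                  * hs_norm e (sqrtA \o dgamma))%E].
Proof.
case: Heig => onb _ lam_gt0 lam_mono _; case: (Hritz) => inV on eigh _ _.
move=> J Phi0 Phih0 sqrtA dgamma err errA.
have idx (i : 'I_J) : (1 <= m + i <= N)%N.
  have iM : (i < M - m + 1)%N := ltn_ord i; rewrite addn1 ltnS in iM.
  rewrite addn_gt0 Hm /= (leq_trans _ HMN) //.
  by rewrite -[leqRHS](subnKC HmM) leq_add2l.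
have idx0 (i : 'I_J) : (0 < m + i)%N by case/andP: (idx i).
pose Psi : 'I_J -> H := subtuple m phih.
have op : orthonormal_tuple ip Phi0.
  by move=> i j; rewrite /Phi0 /subtuple onb.1 ?idx0 // eqn_add2l.
have oPsi : orthonormal_tuple ip Psi.
  by move=> i j; rewrite /Psi /subtuple on ?idx // eqn_add2l.
have oq : orthonormal_tuple ip Phih0 := tuple_act_orthonormal HU.1 oPsi.
pose w (i : 'I_J) := lam (m + i)%N.
have w_gt0 i : 0 < w i by exact: lam_gt0.
have cvp i : op_pow_cvg ip lam phi 2^-1 (Phi0 i) by exact: op_pow_basis_is_cvg.
have cvPsi i : op_pow_cvg ip lam phi 2^-1 (Psi i).
  by apply: (dom_pow_cvg Hip onb); apply/HVh/inV/idx.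
have cvq i : op_pow_cvg ip lam phi 2^-1 (Phih0 i).
  by apply/cvg_ex; eexists; exact: op_pow_cvg_sum.
have sqrtAp i : sqrtA (Phi0 i) = w i `^ 2^-1 *: Phi0 i by exact: op_pow_basis.
have sqr_w i : (w i `^ 2^-1) ^+ 2 = w i.
  by rewrite sqr_powR divff ?pnatr_eq0 // powRr1 // ltW.
have ip_sqrtAp i v : op_pow_cvg ip lam phi 2^-1 v ->
    ip (sqrtA (Phi0 i)) (sqrtA v) = w i * ip (Phi0 i) v.
  move=> cv; rewrite sqrtAp ipZl ipC (ip_op_pow Hip onb cv (idx0 i)) mulrA.
  by rewrite -expr2 sqr_w ipC.
have norm_sqrtAp i : `|sqrtA (Phi0 i)| ^+ 2 = w i.
  by rewrite -Hip ip_sqrtAp // op eqxx mulr1.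
pose K := \sum_i `|sqrtA (Phih0 i)| ^+ 2.
(* Undoing the rotation shows that [K] is the sum of the Ritz values, each bounded below by its
   eigenvalue. *)
have wK : \sum_i w i <= K.
  have -> : K = \sum_i `|sqrtA (Psi i)| ^+ 2.
    rewrite -(sum_norm_tuple_act Hip (fun i => sqrtA (Psi i)) HU.1).
    by apply: eq_bigr => i _; rewrite /sqrtA /Phih0 /tuple_act op_pow_sum.
  apply: ler_sum => i _; rewrite -Hip eigh ?idx //; last exact/inV/idx.
  rewrite on ?idx // eqxx mulr1.
  exact: (ritz_value_ge Hip onb lam_gt0 lam_mono HVh Hritz (idx i)).
have dgammaE v : dgamma v =
    \sum_i ip v (Phi0 i) *: Phi0 i - \sum_i ip v (Phih0 i) *: Phih0 i.
  by rewrite /dgamma !densityE // projection_tuple_act //; exact: HU.1.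
have sqrtA_dgammaE v : sqrtA (dgamma v) =
    \sum_i ip v (Phi0 i) *: sqrtA (Phi0 i) - \sum_i ip v (Phih0 i) *: sqrtA (Phih0 i).
  rewrite dgammaE !finite_rank_diffE /sqrtA op_pow_sum; last by case.
  by apply: eq_bigr => -[i|i] _.
(* The four norms are now brought to the forms [d] and [g] of [overlap_estimates], with weights 1
   and [K = J] for the plain norms, and weights [w] for the energy norms. *)
have errE : err = Num.sqrt (J%:R + J%:R - 2 * \sum_i ip (Phih0 i) (Phi0 i)).
  rewrite -(sum_norm_diff Hip op oq); congr Num.sqrt.
  by apply: eq_bigr => i _; rewrite distrC.
have errAE : errA = Num.sqrt (\sum_i w i + K - 2 * \sum_i w i * ip (Phih0 i) (Phi0 i)).
  congr Num.sqrt; rewrite mulr_sumr -big_split -sumrB; apply: eq_bigr => i _ /=.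
  by rewrite /sqrtA op_powB // (normB_ip Hip) norm_sqrtAp ip_sqrtAp // (ipC _ (Phi0 i)).
have hsE : hs_norm e dgamma =
    (Num.sqrt (J%:R + J%:R - 2 * \sum_i \sum_j ip (Phi0 i) (Phih0 j) ^+ 2))%:E.
  rewrite (funext dgammaE) (hs_norm_diff Hip) //.
  congr (Num.sqrt (_ + _ - 2 * _))%:E.
  - by under eq_bigr do rewrite (orthonormal_norm Hip) //; rewrite sumr_const card_ord.
  - by under eq_bigr do rewrite (orthonormal_norm Hip) //; rewrite sumr_const card_ord.
have hsAE : hs_norm e (sqrtA \o dgamma) =
    (Num.sqrt (\sum_i w i + K - 2 * \sum_i \sum_j w i * ip (Phi0 i) (Phih0 j) ^+ 2))%:E.
  rewrite [sqrtA \o dgamma](funext sqrtA_dgammaE) (hs_norm_diff Hip) //.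
  congr (Num.sqrt (_ + _ - 2 * _))%:E; first by apply: eq_bigr => i _.
  apply: eq_bigr => i _; apply: eq_bigr => j _.
  by rewrite ip_sqrtAp // mulrCA expr2.
have sum1 : \sum_(i < J) 1 = J%:R :> R by rewrite sumr_const card_ord.
have [lo1 hi1] := overlap_estimates Hip op oPsi HU (w := fun=> 1) (K := J%:R)
  (fun=> ler01) ltac:(by rewrite sum1).
have [loA hiA] := overlap_estimates Hip op oPsi HU (w := w) (fun i => ltW (w_gt0 i)) wK.
have mul1E (F : 'I_J -> R) : \sum_i 1 * F i = \sum_i F i.
  by apply: eq_bigr => i _; rewrite mul1r.
have mul1E2 (F : 'I_J -> 'I_J -> R) : \sum_i \sum_j 1 * F i j = \sum_i \sum_j F i j.
  by apply: eq_bigr => i _; exact: mul1E.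
rewrite sum1 mul1E mul1E2 in lo1 hi1.
(* [hiA] is the bound with constant 1; both stated constants are square roots of 1 plus a
   nonnegative term. *)
have errA_le (c : R) : 1 <= c -> (errA%:E <= (Num.sqrt c)%:E * hs_norm e (sqrtA \o dgamma))%E.
  move=> c1; rewrite hsAE errAE -EFinM lee_fin -sqrtrM ?(le_trans ler01) //.
  (* Inserting the factor [c] requires the squared energy norm [g] to be nonnegative:
     [d <= g <= 2 * d] forces [0 <= d], hence [0 <= g]. *)
  apply: ler_wsqrtr; apply: (le_trans hiA); rewrite ler_peMl //; move: loA hiA; lra.
have lam_ge0 k : (0 < k)%N -> 0 <= lam k by move=> k0; exact/ltW/lam_gt0.
have M0 : (0 < M)%N by exact: leq_trans HmM.
split.
- rewrite hsE errE -EFinM !lee_fin; split; last exact: ler_wsqrtr.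
  by apply: sqrt_estimate => //; move: lo1 hi1; lra.
- split.
    rewrite hsAE errAE -EFinM lee_fin.
    by apply: sqrt_estimate => //; move: loA hiA; lra.
  (* The norm being finite, the extended real under [sqrte] is a real number, and the factor takes
     the form [Num.sqrt c]. *)
  rewrite hsE -EFin_expe -EFinM -EFinD /=; apply: errA_le.
  by rewrite lerDl mulr_ge0 ?sqr_ge0 // divr_ge0 ?mulr_ge0 ?lam_ge0.
- by apply: errA_le; rewrite lerDl divr_ge0 ?mulr_ge0 ?lam_ge0.
Qed.
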